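(* Let $V_1,\dots,V_s$ be finite-dimensional $\Bbbk$-vector spaces, let $\mathbf{d}=(d_1,\dots,d_s)$ be a tuple of nonnegative integers, and let $M \in S^{\mathbf{d}}V = S^{d_1}V_1\otimes\cdots\otimes S^{d_s}V_s$ be a multihomogeneous polynomial of multidegree $\mathbf{d}$. Let $\mathbf{a}=(a_1,\dots,a_s)$ be a tuple of integers with $0\le a_i\le d_i$ for all $i$. If the catalecticant $C^{\operatorname{supp}(\mathbf{d}-\mathbf{a})}_M$ is injective, then $$ r_{MH}(M) \geq \operatorname{rank}(C^{\mathbf{d}-\mathbf{a}}_M) + \dim \Sigma_{\mathbf{a}}(M) + 1 , $$ where $\dim\varnothing = -1$.
   Context: $\Bbbk$ is an algebraically closed field of characteristic $0$. Multihomogeneous rank: $r_{MH}(M)$ is the least $r$ such that $M = \sum_{k=1}^r c_k\, \ell_{1,k}^{d_1}\cdots \ell_{s,k}^{d_s}$ with scalars $c_k \in \Bbbk$ and $\ell_{i,k}\in V_i$. Catalecticants: for a tuple $\mathbf{b}$ with $0 \le b_i\le d_i$, put $S^{\mathbf{b}}V^* = S^{b_1}V_1^*\otimes\cdots\otimes S^{b_s}V_s^*$. If $\{x_{i,1},\dots,x_{i,n_i}\}$ is a basis of $V_i$ with dual basis $\{\partial_{i,1},\dots,\partial_{i,n_i}\}$ of $V_i^*$, elements of $S^{\mathbf{b}}V^*$ act on $S^{\mathbf{d}}V$ as constant-coefficient differential operators, $\partial_{i,m}$ acting as $\partial/\partial x_{i,m}$. The catalecticant is the linear map $C^{\mathbf{b}}_M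 : S^{\mathbf{b}}V^* \to S^{\mathbf{d}-\mathbf{b}}V$, $D\mapsto DM$. Sums and differences of tuples are elementwise. For a tuple $\mathbf{b}$ of nonnegative integers, $\operatorname{supp}(\mathbf{b}) = (e_1,\dots,e_s)$ where $e_i = 1$ if $b_i>0$ and $e_i=0$ otherwise. $\Sigma_{\mathbf{a}}(M) \subset \prod_{i=1}^s\mathbb{P}V_i^*$ is the subvariety defined by the image of $C^{\mathbf{a}}_M$, regarded as a set of multihomogeneous polynomials of multidegree $\mathbf{d}-\mathbf{a}$ on $\prod_i V_i^*$; here $\mathbb{P}V_i^*$ is the space of lines in $V_i^*$, with homogeneous coordinates $x_{i,1},\dots,x_{i,n_i}$.
   Formalization: Σ_a(M) is taken in the product of the PV_i^* over i with a_i < d_i only; with all factors the claim is false (d=(1,3), a=(1,1), M = x_{1,1}x_{2,1}^2x_{2,2}, dim V_1 = dim V_2 = 2: rank ≤ 3, bound 4). *)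

(* Defs.v *)
From HB Require Import structures.
From mathcomp Require Import all_boot all_order all_algebra.
From mathcomp Require Import classical_sets.
From mathcomp Require Import ssrcomplements mpoly.

Set Implicit Arguments.
Unset Strict Implicit.
Unset Printing Implicit Defensive.

Import GRing.Theory.

Local Open Scope ring_scope.

(* Tuples (b_1, ..., b_s) of nonnegative integers are functions 'I_s -> nat.  *)

Definition tupB s (d b : 'I_s -> nat) : 'I_s -> nat := fun i => (d i - b i)%N.

Definition tup_supp s (b : 'I_s -> nat) : 'I_s -> nat := fun i => (0 < b i)%N.

(* Given n = (n_1, ..., n_s), V_i is K^(n_i), with basis x_{i,1}, ...,        *)
(* x_{i,n_i}.  The symmetric algebra of V_1 + ... + V_s is the polynomial     *)
(* ring in \sum_i n_i variables, x_{i,j} being 'X_(var i j), j : 'I_(n i),    *)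
(* and S^d V is its subspace of forms of multidegree d.  The same type serves *)
(* for S^b V^*, a variable then standing for the dual vector \partial_{i,j}.  *)

Definition nvars s (n : 'I_s -> nat) : nat := (\sum_i n i)%N.

Definition var s (n : 'I_s -> nat) (i : 'I_s) (j : 'I_(n i)) : 'I_(nvars n) :=
  tagnat.Rank i j.
Arguments var {s n} i j.

Definition var_block s (n : 'I_s -> nat) (k : 'I_(nvars n)) : 'I_s :=
  tagnat.sig1 k.

Definition var_index s (n : 'I_s -> nat) (k : 'I_(nvars n)) :
    'I_(n (var_block k)) :=
  tagnat.sig2 k.

Definition mhdeg s (n : 'I_s -> nat) (i : 'I_s) (m : 'X_{1..(nvars n)}) : nat :=
  \sum_(j < n i) m (var i j).

Definition mhomog_pred (K : fieldType) s (n d : 'I_s -> nat) :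
    pred {mpoly K[nvars n]} :=
  fun p => all (fun m => [forall i, mhdeg i m == d i]) (msupp p).
Arguments mhomog_pred K {s} n d p /.

Definition mhomog (K : fieldType) s (n d : 'I_s -> nat) :
    qualifier 0 {mpoly K[nvars n]} :=
  [qualify p | mhomog_pred K n d p].

Notation "d .-mhomog" := (@mhomog _ _ _ d) (at level 1, format "d .-mhomog").

Section MultiForms.
Variables (K : fieldType) (s : nat) (n : 'I_s -> nat).
Implicit Types (b d : 'I_s -> nat) (m : 'X_{1..(nvars n)}).
Implicit Types p q D : {mpoly K[nvars n]}.

Lemma mhomogP d p :
  reflect {in msupp p, forall m i, mhdeg i m = d i} (p \is d.-mhomog).
Proof.
apply: (iffP allP) => [h m /h /forallP hm i|h m /h hm]; first exact/eqP.
by apply/forallP => i; apply/eqP.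
Qed.

Lemma mhomog_submod_closed d : submod_closed (mhomog_pred K n d).
Proof.
split=> [|c p q]; first by rewrite unfold_in /= msupp0.
move=> /mhomogP hp /mhomogP hq; apply/mhomogP => m.
by move/msuppD_le; rewrite mem_cat => /orP[/msuppZ_le /hp|/hq].
Qed.

HB.instance Definition _ d :=
  GRing.isSubmodClosed.Build K {mpoly K[nvars n]} (mhomog_pred K n d)
    (mhomog_submod_closed d).

Lemma mhdegD m1 m2 i : mhdeg i (m1 + m2)%MM = (mhdeg i m1 + mhdeg i m2)%N.
Proof. by rewrite /mhdeg -big_split; apply: eq_bigr => j _; rewrite mnmDE. Qed.

Lemma mdeg_mhdeg m : mdeg m = (\sum_i mhdeg i m)%N.
Proof.
rewrite mdegE /nvars (reindex _ (@tagnat.rank_bij_on _ n)) /=.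
rewrite /mhdeg sig_big_dep /=; apply: eq_bigr => -[i j] _.
by rewrite tagnat.rankE.
Qed.

End MultiForms.

Record mhform (K : fieldType) (s : nat) (n d : 'I_s -> nat) := MHForm {
  mpoly_of_mhform :> {mpoly K[nvars n]};
  _ : mpoly_of_mhform \is d.-mhomog
}.
Arguments mhform K {s} n d.

Section MHFormTheory.
Variables (K : fieldType) (s : nat) (n d : 'I_s -> nat).

HB.instance Definition _ := [isSub for @mpoly_of_mhform K s n d].
HB.instance Definition _ := [Choice of mhform K n d by <:].
HB.instance Definition _ := [SubChoice_isSubLmodule of mhform K n d by <:].

Lemma mhform_mhomog (p : mhform K n d) :
  (p : {mpoly K[nvars n]}) \is d.-mhomog.
Proof. by case: p. Qed.

Definition mhbasis : seq 'X_{1..(nvars n)} :=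
  [seq m <- [seq bmnm m | m <- enum {: 'X_{1..(nvars n) < (\sum_i d i).+1}}]
     | [forall i, mhdeg i m == d i]].

Lemma mhbasis_uniq : uniq mhbasis.
Proof.
by apply: filter_uniq; rewrite map_inj_uniq ?enum_uniq //; apply: val_inj.
Qed.

Lemma mem_mhbasis m : (m \in mhbasis) = [forall i, mhdeg i m == d i].
Proof.
rewrite mem_filter; apply: andb_idr => /forallP hm.
have lt_m : (mdeg m < (\sum_i d i).+1)%N.
  by rewrite ltnS mdeg_mhdeg leq_sum // => i _; rewrite (eqP (hm i)).
by apply/mapP; exists (BMultinom lt_m); rewrite ?mem_enum.
Qed.

Lemma mhform_vect_axiom : vector_axiom (size mhbasis) (mhform K n d).
Proof.
pose f (p : mhform K n d) : 'rV[K]_(size mhbasis) :=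
  \row_i (p : {mpoly K[nvars n]})@_(nth 0%MM mhbasis i).
exists f => [c p q|].
  by apply/rowP => i; rewrite !mxE /= mcoeffD mcoeffZ.
pose g (r : 'rV[K]_(size mhbasis)) : {mpoly K[nvars n]} :=
  \sum_i r 0 i *: 'X_[nth 0%MM mhbasis i].
have gP r : g r \is d.-mhomog.
  apply: rpred_sum => i _; apply: rpredZ; apply/mhomogP => m.
  rewrite msuppX inE => /eqP-> j; apply/eqP; move: j; apply/forallP.
  by rewrite -mem_mhbasis mem_nth.
have gE r (i : 'I_(size mhbasis)) : (g r)@_(nth 0%MM mhbasis i) = r 0 i.
  rewrite /g raddf_sum /= (bigD1 i) //= mcoeffZ mcoeffX eqxx mulr1.
  rewrite big1 ?addr0 // => j ne_ji; rewrite mcoeffZ mcoeffX.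
  by rewrite nth_uniq ?mhbasis_uniq // (inj_eq val_inj) (negbTE ne_ji) mulr0.
exists (fun r => MHForm (gP r)) => [p|r]; last first.
  by apply/rowP => i; rewrite mxE /= gE.
apply/val_inj/mpolyP => m /=.
have [m_in|m_out] := boolP (m \in mhbasis).
  have lt_m : (index m mhbasis < size mhbasis)%N by rewrite index_mem.
  by have := gE (f p) (Ordinal lt_m); rewrite /= nth_index // mxE /= nth_index.
have no q : q \is d.-mhomog -> q@_m = 0.
  move/mhomogP => hq; apply/eqP; apply: contraR m_out.
  rewrite -mcoeff_msupp mem_mhbasis => /hq hm.
  by apply/forallP => i; rewrite hm.
by rewrite !no ?mhform_mhomog.
Qed.

HB.instance Definition _ :=
  Lmodule_hasFinDim.Build K (mhform K n d) mhform_vect_axiom.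

End MHFormTheory.

Section Catalecticant.
Variables (K : fieldType) (s : nat) (n : 'I_s -> nat).
Implicit Types (b d : 'I_s -> nat) (p D : {mpoly K[nvars n]}).

(* D acting on p as a constant-coefficient differential operator: the         *)
(* variables of D act as the corresponding partial derivatives.               *)
Definition diffop D p : {mpoly K[nvars n]} :=
  \sum_(m <- msupp D) D@_m *: p^`M[m].

Lemma diffopwE k D p : (msize D <= k)%N ->
  diffop D p = \sum_(m : 'X_{1..(nvars n) < k}) D@_m *: p^`M[m].
Proof.
move=> leDk; pose F (m : 'X_{1..(nvars n)}) := D@_m *: p^`M[m].
rewrite /diffop (big_mksub 'X_{1..(nvars n) < k}) /=; first last.
+ by move=> m /msize_mdeg_lt /leq_trans; apply.
+ exact: msupp_uniq.
rewrite big_rmcond //= => m.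
by move/memN_msupp_eq0 => ->; rewrite scale0r.
Qed.

Lemma diffop_linearl c D1 D2 p :
  diffop (c *: D1 + D2) p = c *: diffop D1 p + diffop D2 p.
Proof.
pose k := maxn (msize (c *: D1 + D2)) (maxn (msize D1) (msize D2)).
rewrite !(@diffopwE k) ?leq_max ?leqnn ?orbT //.
rewrite scaler_sumr -big_split; apply: eq_bigr => m _ /=.
by rewrite mcoeffD mcoeffZ scalerDl scalerA.
Qed.

Lemma diffop_mhomog b d D p :
  D \is b.-mhomog -> p \is d.-mhomog -> diffop D p \is (tupB d b).-mhomog.
Proof.
move=> /mhomogP hD /mhomogP hp; rewrite /diffop big_seq.
apply: rpred_sum => m /hD hm; apply: rpredZ; apply/mhomogP => m'.
rewrite mcoeff_msupp mcoeff_mderivm => nz i.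
have /hp/(_ i) : (m + m')%MM \in msupp p.
  by rewrite mcoeff_msupp; apply: contra_neq nz => ->; rewrite mul0rn.
by rewrite mhdegD hm /tupB => <-; rewrite addKn.
Qed.

Variables (d : 'I_s -> nat) (M : mhform K n d) (b : 'I_s -> nat).

Definition catal_fun (D : mhform K n b) : mhform K n (tupB d b) :=
  MHForm (diffop_mhomog (mhform_mhomog D) (mhform_mhomog M)).

Lemma catal_fun_is_linear : linear catal_fun.
Proof. by move=> c D1 D2; apply: val_inj; rewrite /= diffop_linearl. Qed.

HB.instance Definition _ :=
  GRing.isLinear.Build K (mhform K n b) (mhform K n (tupB d b)) _ catal_fun
    catal_fun_is_linear.

Definition catalecticant : 'Hom(mhform K n b, mhform K n (tupB d b)) :=
  linfun catal_fun.

Lemma catalecticantE (D : mhform K n b) :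
  catalecticant D = diffop D M :> {mpoly K[nvars n]}.
Proof. by rewrite lfunE. Qed.

End Catalecticant.

Section Rank.
Variables (K : fieldType) (s : nat) (n : 'I_s -> nat).

Definition linform (i : 'I_s) (l : 'rV[K]_(n i)) : {mpoly K[nvars n]} :=
  \sum_(j < n i) l 0 j *: 'X_(var i j).

Definition mh_decomposable (d : 'I_s -> nat) (M : mhform K n d) (r : nat) :
    Prop :=
  exists (c : 'I_r -> K) (l : forall (k : 'I_r) (i : 'I_s), 'rV[K]_(n i)),
    M = \sum_(k < r) c k *: \prod_(i < s) linform (l k i) ^+ d i
      :> {mpoly K[nvars n]}.

Definition is_mh_rank (d : 'I_s -> nat) (M : mhform K n d) (r : nat) : Prop :=
  mh_decomposable M r /\ forall r', mh_decomposable M r' -> (r <= r')%N.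

End Rank.

Local Open Scope classical_set_scope.

Section Zariski.
Variables (K : fieldType) (s : nat) (n e : 'I_s -> nat).

(* For a 0/1-tuple e, the points of the product of the PV_i^* over the i with *)
(* e_i = 1: a line in V_i^* for each such i, the zero subspace for the other  *)
(* i.  A vector of V_i^* is given by its coordinates x_{i,j}.                 *)
Record mpoint := MPoint {
  line_of :> forall i : 'I_s, {vspace 'rV[K]_(n i)};
  _ : forall i, \dim (line_of i) = e i
}.

Definition mheval (f : {mpoly K[nvars n]}) (v : forall i, 'rV[K]_(n i)) : K :=
  f.@[fun k => v (var_block k) 0 (var_index k)].

Definition vanishes_at (f : {mpoly K[nvars n]}) (L : mpoint) : Prop :=
  forall v : forall i, 'rV[K]_(n i), (forall i, v i \in L i) -> mheval f v = 0.

Definition zero_locus (F : set {mpoly K[nvars n]}) : set mpoint :=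
  [set L | forall f, F f -> vanishes_at f L].

Definition zariski_closed (Z : set mpoint) : Prop :=
  exists F : set {mpoly K[nvars n]},
    (forall f, F f -> exists b : 'I_s -> nat, f \is b.-mhomog) /\
    Z = zero_locus F.

Definition zariski_irreducible (Z : set mpoint) : Prop :=
  Z !=set0 /\
  forall Z1 Z2 : set mpoint, zariski_closed Z1 -> zariski_closed Z2 ->
    Z `<=` Z1 `|` Z2 -> Z `<=` Z1 \/ Z `<=` Z2.

Definition has_irreducible_chain (X : set mpoint) (m : nat) : Prop :=
  exists Z : nat -> set mpoint,
    (forall k, (k <= m)%N ->
       [/\ zariski_closed (Z k), zariski_irreducible (Z k) & Z k `<=` X]) /\
    (forall k, (k < m)%N -> Z k `<` Z k.+1).

(* delta is the Krull dimension of X, with the convention dim set0 = -1.      *)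
Definition is_dim (X : set mpoint) (delta : int) : Prop :=
  (X = set0 /\ delta = -1) \/
  exists m : nat,
    [/\ delta = m%:Z, has_irreducible_chain X m
      & forall m', has_irreducible_chain X m' -> (m' <= m)%N].

End Zariski.

Arguments mpoint K {s} n e.

(* The equations of Sigma_a(M) have degree d_i - a_i in the coordinates of    *)
(* V_i^*, so the i with d_i = a_i are not involved in them; the ambient       *)
(* variety is the product of the PV_i^* over the remaining i, the support of  *)
(* d - a.  It is the product of all the PV_i^* when a_i < d_i for all i.      *)
(* Keeping the factors with a_i = d_i would multiply Sigma_a(M) by projective *)
(* spaces unrelated to M, and the bound of the rank by its dimension would be *)
(* false: for d = (1, 3), a = (1, 1), n = (2, 2) and the form                 *)
(* M = x_{1,1} x_{2,1}^2 x_{2,2}, of rank 3, the right-hand side would be 4.  *)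
Definition Sigma (K : fieldType) s (n d : 'I_s -> nat) (M : mhform K n d)
    (a : 'I_s -> nat) : set (mpoint K n (tup_supp (tupB d a))) :=
  zero_locus [set f | exists D : mhform K n a,
                        f = catalecticant M a D :> {mpoly K[nvars n]}].
Arguments Sigma {K s n d} M a.

(* Main.v *)
From HB Require Import structures.
Require Import Defs.
From mathcomp Require Import all_boot all_order all_algebra.
From mathcomp Require Import boolp classical_sets.
From mathcomp Require Import mpoly zify.

(* Write e = d - a, M = sum_k c_k prod_i l_(k,i)^(d_i) with r terms, and let  *)
(* g_k = prod_i l_(k,i)^(e_i), h_k = prod_i l_(k,i)^(supp e)_i.  The image U  *)
(* of C_M^a, whose dimension is at least the rank of C_M^e by apolarity, is   *)
(* contained in the span of the g_k and vanishes on Sigma_a(M).  Hence modulo *)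
(* the ideal of Sigma_a(M) the g_k are spanned by t = dim <g_k> - dim U       *)
(* forms, and it suffices to prove dim Sigma_a(M) < t.  Injectivity of        *)
(* C_M^(supp e) says that the h_k span the forms of multidegree supp e; as    *)
(* g_k divides a power of h_k, every form of large multidegree q e is in the  *)
(* ideal of the g_k (this replaces the Nullstellensatz), so modulo the ideal  *)
(* of Sigma_a(M) the forms of multidegree q e span a space of dimension       *)
(* O(q^(t-1)).  On the other hand a chain of irreducible closed sets of       *)
(* length m yields, for some N > 0, 'C(q + m, m) forms of multidegree q N e   *)
(* independent on the largest of them.                                        *)

(** Geometrically, the [g_k] map the product of the projective spaces with [e_i > 0] to a projective
    space. They have no common zero, since they have the same zeros there as the [h_k], which span
    all forms of multidegree [supp e]; as each such [e_i] is positive, the map is finite. The forms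
    of [U] vanish on [Sigma M a], so there the map lands in a projective space of dimension [t - 1].
    Hence [dim Sigma < t], which is the bound because [t] is at most [r] minus the rank.

    Finiteness is replaced by counting forms of multidegree [q e] modulo a vanishing ideal. From
    above, [mhomog_in_power_ideal] and [free_mod_card_le] give growth of degree at most [t - 1] in
    [q]. From below, [ex_free_forms_chain] turns a chain of length [m] into growth of degree [m].
    [bin_growth] makes the two clash in [irreducible_chain_lt]. Apolarity enters through
    [catalecticant_inj_span], [dim_catalecticant_le] and [limg_catalecticant_sub_powers]. *)

Set Implicit Arguments.
Unset Strict Implicit.
Unset Printing Implicit Defensive.

Import GRing.Theory.
Local Open Scope ring_scope.

(** * Calculus of multidegrees *)

Section MultiHomogeneous.
Variables (K : fieldType) (s : nat) (n : 'I_s -> nat).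
Implicit Types (b d : 'I_s -> nat) (p q : {mpoly K[nvars n]}).

Lemma eq_mhomog b d p : b =1 d -> (p \is b.-mhomog) = (p \is d.-mhomog).
Proof. by move=> eq_bd; apply/mhomogP/mhomogP => h m /h hm i; rewrite hm. Qed.

Lemma mhomogX b (m : 'X_{1..nvars n}) :
  (forall i, mhdeg i m = b i) -> 'X_[m] \is @mhomog K s n b.
Proof. by move=> hm; apply/mhomogP => m'; rewrite msuppX inE => /eqP->. Qed.

Lemma mhdeg0 i : mhdeg i (0%MM : 'X_{1..nvars n}) = 0%N.
Proof. by rewrite /mhdeg big1 // => j _; rewrite mnm0E. Qed.

Lemma mhdeg1 i (k : 'I_(nvars n)) : mhdeg i U_(k)%MM = (var_block k == i).
Proof.
rewrite /mhdeg; have [<-|ne_i] := eqVneq.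
  rewrite (bigD1 (var_index k)) //= mnm1E /var /var_index tagnat.sig2K eqxx.
  rewrite big1 // => j ne_j; rewrite mnm1E -[X in X == _]tagnat.sig2K.
  by rewrite (inj_eq (@tagnat.rank_inj _ _)) eq_Tagged eq_sym (negbTE ne_j).
rewrite big1 // => j _; rewrite mnm1E; case: eqP => // kE.
by rewrite kE /var_block /var tagnat.Rank1K eqxx in ne_i.
Qed.

Lemma mhomog1 : 1 \is @mhomog K s n (fun=> 0%N).
Proof. by rewrite -mpolyX0; apply: mhomogX => i; rewrite mhdeg0. Qed.

Lemma mhomogM b d p q : p \is b.-mhomog -> q \is d.-mhomog ->
  p * q \is (fun i => b i + d i)%N.-mhomog.
Proof.
move=> /mhomogP hp /mhomogP hq; apply/mhomogP => m /msuppM_le.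
by case/allpairsP => -[m1 m2] /= [/hp h1 /hq h2 ->] i; rewrite mhdegD h1 h2.
Qed.

Lemma mhomog_prod (I : Type) (r : seq I) (B : I -> 'I_s -> nat)
    (F : I -> {mpoly K[nvars n]}) : (forall j, F j \is (B j).-mhomog) ->
  \prod_(j <- r) F j \is (fun i => \sum_(j <- r) B j i)%N.-mhomog.
Proof.
move=> hF; elim: r => [|j r IHr].
  by rewrite big_nil; rewrite (eq_mhomog (d := fun=> 0%N)) ?mhomog1 // => i;
    rewrite big_nil.
rewrite big_cons (eq_mhomog (d := fun i => B j i + \sum_(k <- r) B k i)%N).
  exact: mhomogM.
by move=> i; rewrite big_cons.
Qed.

Lemma mhomogXn b p k :
  p \is b.-mhomog -> p ^+ k \is (fun i => k * b i)%N.-mhomog.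
Proof.
move=> hp; elim: k => [|k IHk]; first exact: mhomog1.
by rewrite exprS; apply: mhomogM.
Qed.

Lemma linform_mhomog i (l : 'rV[K]_(n i)) :
  linform l \is (fun j => j == i : nat).-mhomog.
Proof.
apply: rpred_sum => j _; apply: rpredZ; apply: mhomogX => i'.
by rewrite mhdeg1 /var_block /var tagnat.Rank1K eq_sym.
Qed.

Lemma linform_prod_mhomog b (l : forall i, 'rV[K]_(n i)) :
  \prod_i linform (l i) ^+ b i \is b.-mhomog.
Proof.
rewrite (eq_mhomog (d := fun i => \sum_(j < s) b j * (i == j))%N); last first.
  by move=> i; rewrite (bigD1 i) //= eqxx muln1 big1 ?addn0 // => j ne_j;
    rewrite eq_sym (negbTE ne_j) muln0.
apply: (@mhomog_prod _ _ (fun j i => b j * (i == j))%N) => j.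
exact/mhomogXn/linform_mhomog.
Qed.

End MultiHomogeneous.

(** * Evaluation of forms, and derivatives of products of powers of linear forms *)

Section Evaluation.
Variables (K : fieldType) (s : nat) (n : 'I_s -> nat).
Implicit Types (b d : 'I_s -> nat) (p q : {mpoly K[nvars n]}).
Implicit Types v l : forall i, 'rV[K]_(n i).

Lemma var_eta v (i : 'I_s) (j : 'I_(n i)) :
  v (var_block (var i j)) 0 (var_index (var i j)) = v i 0 j.
Proof.
(* The type of [var_index] depends on [var_block], so neither can be rewritten alone; packing the
   pair as a dependent sum rewrites both at once. *)
pose g (x : {i & 'I_(n i)}) := v (tag x) 0 (tagged x).
by rewrite -[RHS]/(g (Tagged _ j)) -(tagnat.rankK (Tagged _ j)).
Qed.

Lemma mheval_linform v i (c : 'rV[K]_(n i)) :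
  mheval (linform c) v = \sum_j c 0 j * v i 0 j.
Proof.
rewrite /mheval /linform raddf_sum /=; apply: eq_bigr => j _.
by rewrite mevalZ mevalXU var_eta.
Qed.

Lemma prod_var_block (R : comPzRingType) (F : 'I_s -> R) (m : 'X_{1..nvars n}) :
  \prod_k F (var_block k) ^+ m k = \prod_i F i ^+ mhdeg i m.
Proof.
rewrite /nvars (reindex _ (@tagnat.rank_bij_on _ n)) /=.
under [RHS]eq_bigr do rewrite /mhdeg -prodrXr.
rewrite [RHS]sig_big_dep /=; apply: eq_bigr => -[i j] _ /=.
by rewrite tagnat.rankE /= /var_block tagnat.Rank1K.
Qed.

Lemma mheval_scale b p (t : 'I_s -> K) v : p \is b.-mhomog ->
  mheval p (fun i => t i *: v i) = \prod_i t i ^+ b i * mheval p v.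
Proof.
move=> /mhomogP hp; rewrite /mheval !mevalE mulr_sumr.
rewrite big_seq [RHS]big_seq; apply: eq_bigr => m /hp hm.
rewrite mulrCA; congr (_ * _).
under eq_bigr do rewrite mxE exprMn.
rewrite big_split /= prod_var_block; congr (_ * _).
by apply: eq_bigr => i _; rewrite hm.
Qed.

(** The entry of [c] at [var_index k] is well typed only in block [i]; the family [v] extending [c]
    lets one formula cover every [k]. *)
Lemma mderiv_linform (k : 'I_(nvars n)) i (c : 'rV[K]_(n i)) v : v i = c ->
  (linform c)^`M(k) =
    ((i == var_block k)%:R * v (var_block k) 0 (var_index k))%:MP.
Proof.
move=> <-; rewrite /linform raddf_sum /=.
have dX j : (v i 0 j *: 'X_(var i j) : {mpoly K[nvars n]})^`M(k) =
    (v i 0 j *+ (var i j == k))%:MP.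
  rewrite mderivZ mderivX mnm1E; case: eqP => [->|_].
    by rewrite -[X in (X - _)%MM]add0m addmK mpolyX0 scale1r mulr1n alg_mpolyC.
  by rewrite scale0r scaler0 mulr0n mpolyC0.
under eq_bigr do rewrite dX.
rewrite -raddf_sum /=; congr _%:MP.
have kE : k = var (var_block k) (var_index k) by rewrite /var tagnat.sig2K.
have [iE|ne_i] := eqVneq i (var_block k).
  subst i; rewrite mul1r (bigD1 (var_index k)) //= -kE eqxx mulr1n big1 ?addr0 // => j.
  move=> ne_j; rewrite -[X in _ == X]tagnat.sig2K.
  by rewrite (inj_eq (@tagnat.rank_inj _ _)) eq_Tagged (negbTE ne_j).
rewrite mul0r big1 // => j _; case: eqP => [kE'|_]; last by rewrite mulr0n.
by rewrite -kE' /var_block /var tagnat.Rank1K eqxx in ne_i.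
Qed.

Lemma mderiv_linform_prod (k : 'I_(nvars n)) d l : (0 < d (var_block k))%N ->
  (\prod_i linform (l i) ^+ d i)^`M(k) =
  ((d (var_block k))%:R * l (var_block k) 0 (var_index k)) *:
    \prod_i linform (l i) ^+ (d i - (i == var_block k)).
Proof.
set i0 := var_block k => d_gt0.
rewrite (bigD1 i0) //= [in RHS](bigD1 i0) //= mderivM eqxx.
have dX i m : (linform (l i) ^+ m)^`M(k) =
    (m%:R * ((i == i0)%:R * l i0 0 (var_index k))) *: linform (l i) ^+ m.-1.
  elim: m => [|m IHm]; first by rewrite expr0 mderivC mul0r scale0r.
  rewrite exprS mderivM IHm (mderiv_linform _ (erefl (l i))) mul_mpolyC.
  set c := _ * l _ _ _; rewrite -scalerAr -[in X in _ + _ *: X]exprS.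
  case: m {IHm} => [|m] /=; first by rewrite mul0r scale0r addr0 mul1r.
  by rewrite -scalerDl [in RHS](mulrS 1 m.+1) mulrDl mul1r.
have -> : (\prod_(i < s | i != i0) linform (l i) ^+ d i)^`M(k) = 0.
  apply: (big_rec (fun p => p^`M(k) = 0)) => [|i p ne_i dp].
    by rewrite -mpolyC1 mderivC.
  by rewrite mderivM dp mulr0 addr0 dX (negbTE ne_i) mul0r mulr0 scale0r mul0r.
rewrite mulr0 addr0 dX eqxx mul1r -scalerAl subn1; congr (_ *: (_ * _)).
by apply: eq_bigr => i /negbTE->; rewrite subn0.
Qed.

Lemma mnm_ind (P : 'X_{1..nvars n} -> Prop) :
  P 0%MM -> (forall m k, P m -> P (m + U_(k))%MM) -> forall m, P m.
Proof.
move=> P0 PS m; elim: {m}(mdeg m) {-2}m (erefl (mdeg m)) => [|N IHN] m dm.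
  by move/eqP: dm; rewrite mdeg_eq0 => /eqP->.
have [k mk_gt0] : exists k, (0 < m k)%N.
  apply/existsP; rewrite -[X in is_true X]negbK negb_exists; apply/negP => /forallP m0.
  suff: mdeg m = 0%N by rewrite dm.
  by rewrite mdegE big1 // => k _; apply/eqP; rewrite -leqn0 leqNgt m0.
have le_km : (U_(k) <= m)%MM.
  by apply/mnm_lepP => j; rewrite mnm1E; case: eqP => [<-|].
rewrite -(submK le_km); apply/PS/IHN.
by move: dm; rewrite -{1}(submK le_km) mdegD mdeg1 addn1 => -[].
Qed.

(** Each derivative in block [i] lowers the exponent of [l i] by one and brings out that exponent
    and a coordinate of [l i]; the exponents build falling factorials, the coordinates the value of
    the monomial at [l]. *)
Lemma mderivm_linform_prod (m : 'X_{1..nvars n}) d l :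
  (forall i, mhdeg i m <= d i)%N ->
  (\prod_i linform (l i) ^+ d i)^`M[m] =
  ((\prod_i (d i ^_ mhdeg i m)%:R) * mheval 'X_[m] l) *:
    \prod_i linform (l i) ^+ (d i - mhdeg i m).
Proof.
elim/mnm_ind: m => [|m k IHm] le_md.
  rewrite mderivm0m mpolyX0 /mheval meval1 mulr1.
  rewrite [X in X *: _]big1 ?scale1r => [|i _]; last by rewrite mhdeg0 ffactn0.
  by apply: eq_bigr => i _; rewrite mhdeg0 subn0.
rewrite mderivmDm mderivmU1m IHm => [|i]; last first.
  by apply: leq_trans (le_md i); rewrite mhdegD leq_addr.
have dk_gt0 : (0 < d (var_block k) - mhdeg (var_block k) m)%N.
  by rewrite subn_gt0; have := le_md (var_block k); rewrite mhdegD mhdeg1 eqxx addn1.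
rewrite mderivZ mderiv_linform_prod // scalerA; congr (_ *: _).
  rewrite mpolyXD /mheval mevalM mevalXU mulrACA; congr (_ * _).
  rewrite (bigD1 (var_block k)) // [in RHS](bigD1 (var_block k)) //=.
  rewrite mhdegD mhdeg1 eqxx addn1 ffactnSr natrM mulrAC; congr (_ * _).
  by apply: eq_bigr => i ne_i; rewrite mhdegD mhdeg1 eq_sym (negbTE ne_i) addn0.
by apply: eq_bigr => i _; rewrite mhdegD mhdeg1 subnDA eq_sym.
Qed.

End Evaluation.

(** * Apolarity: injectivity and rank of catalecticants *)

Section Apolarity.
Variables (K : fieldType) (charK0 : [pchar K] =i pred0).
Variables (s : nat) (n : 'I_s -> nat).
Implicit Types (b d : 'I_s -> nat) (p q D : {mpoly K[nvars n]}).
Implicit Types l : forall i, 'rV[K]_(n i).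

Lemma natr_neq0 k : (k%:R == 0 :> K) = (k == 0%N).
Proof. exact: (pcharf0P K).1. Qed.

(** The basic apolarity formula: an operator acts on a product of powers through its value at [l].
    It serves both to show that forms vanishing at all the points annihilate [M] and to compute the
    image of a catalecticant. *)
Lemma diffop_linform_prod b d D l :
  D \is b.-mhomog -> (forall i, b i <= d i)%N ->
  diffop D (\prod_i linform (l i) ^+ d i) =
  ((\prod_i (d i ^_ b i)%:R) * mheval D l) *:
    \prod_i linform (l i) ^+ (d i - b i).
Proof.
move=> /mhomogP hD le_bd; rewrite {2}[D]mpolyE /mheval raddf_sum /=.
rewrite mulr_sumr scaler_suml /diffop big_seq [RHS]big_seq.
apply: eq_bigr => m /hD hm; rewrite mderivm_linform_prod => [|i]; last by rewrite hm.
rewrite mevalZ scalerA mulrCA; congr (_ * (_ * _) *: _).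
  by apply: eq_bigr => i _; rewrite hm.
by apply: eq_bigr => i _; rewrite hm.
Qed.

Lemma diffop_sumr (I : Type) (r : seq I) (c : I -> K) F D :
  diffop D (\sum_(k <- r) c k *: F k) = \sum_(k <- r) c k *: diffop D (F k).
Proof.
rewrite /diffop; under [RHS]eq_bigr do rewrite scaler_sumr.
rewrite exchange_big; apply: eq_bigr => m _ /=.
rewrite raddf_sum scaler_sumr; apply: eq_bigr => k _ /=.
by rewrite mderivmZ !scalerA mulrC.
Qed.

Lemma diffop_mderivm D p m : diffop D p^`M[m] = (diffop D p)^`M[m].
Proof.
rewrite /diffop raddf_sum; apply: eq_bigr => m' _ /=.
by rewrite mderivmZ -!mderivmDm addmC.
Qed.

Lemma diffopX m p : diffop 'X_[m] p = p^`M[m].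
Proof. by rewrite /diffop msuppX big_seq1 mcoeffX eqxx scale1r. Qed.

Lemma mderivm_mcoeff0 (m : 'X_{1..nvars n}) p :
  (p^`M[m])@_0 = p@_m *+ \prod_k (m k)`!.
Proof.
rewrite mcoeff_mderivm addm0; congr (_ *+ _).
by apply: eq_bigr => k _; rewrite ffactnn.
Qed.

Lemma mhomog_eq0 b p : p \is b.-mhomog ->
  (forall m, (forall i, mhdeg i m = b i) -> p@_m = 0) -> p = 0.
Proof.
move=> /mhomogP hp p0; apply/mpolyP => m; rewrite mcoeff0.
apply/eqP/contraT => pm; have := hp m; rewrite mcoeff_msupp => /(_ pm) /p0 pm0.
by rewrite pm0 eqxx in pm.
Qed.

Lemma mem_mhbasisP b m : reflect (forall i, mhdeg i m = b i) (m \in mhbasis n b).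
Proof. by rewrite mem_mhbasis; apply: (iffP forallP) => h i; apply/eqP. Qed.

Lemma mhform_sumE b (I : Type) (r : seq I) (c : I -> K) (F : I -> mhform K n b) :
  \sum_(k <- r) c k *: F k = \sum_(k <- r) c k *: (F k : {mpoly K[nvars n]})
    :> {mpoly K[nvars n]}.
Proof. by elim: r => [|k r IHr]; rewrite ?big_nil // !big_cons -IHr. Qed.

Definition power_products_span r b (l : 'I_r -> forall i, 'rV[K]_(n i)) :=
  forall m : 'X_{1..nvars n}, (forall i, mhdeg i m = b i) ->
  exists y : 'I_r -> K,
    'X_[m] = \sum_k y k *: \prod_i linform (l k i) ^+ b i.

(* Evaluation of a form of multidegree b at l is, up to a nonzero factor, its *)
(* apolarity pairing with prod_i l_i^(b_i), so a form D vanishing at all the  *)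
(* l k satisfies D M = 0.                                                     *)
Lemma catalecticant_inj_span r d (M : mhform K n d) (c : 'I_r -> K)
    (l : 'I_r -> forall i, 'rV[K]_(n i)) b : (forall i, b i <= d i)%N ->
  M = \sum_k c k *: \prod_i linform (l k i) ^+ d i :> {mpoly K[nvars n]} ->
  injective (catalecticant M b) -> power_products_span b l.
Proof.
move=> le_bd ME inj m0 /mem_mhbasisP m0_in.
set B := mhbasis n b in m0_in *; pose mn (j : 'I_(size B)) := nth 0%MM B j.
have mnP j i : mhdeg i (mn j) = b i by have/mem_mhbasisP := mem_nth 0%MM (ltn_ord j).
pose A := \matrix_(k < r, j < size B) mheval 'X_[mn j] (l k).
(* A relation among the columns of [A] is a form [D0] vanishing at every [l k]; then [D0] kills [M],
   so injectivity gives [D0 = 0]. *)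
have fullA : row_full A.
  rewrite /row_full -mxrank_tr; apply: inj_row_free => v vA0.
  pose D0 : {mpoly K[nvars n]} := \sum_j v 0 j *: 'X_[mn j].
  have D0P : D0 \is b.-mhomog.
    by apply: rpred_sum => j _; apply: rpredZ; apply: mhomogX => i; rewrite mnP.
  suff /(congr1 val)/= D00 : MHForm D0P = 0.
    apply/rowP => j; rewrite mxE -[RHS](mcoeff0 _ (mn j)) -D00 raddf_sum /=.
    rewrite (bigD1 j) //= mcoeffZ mcoeffX eqxx mulr1 big1 ?addr0 // => j' ne_j.
    rewrite mcoeffZ mcoeffX nth_uniq ?mhbasis_uniq // (inj_eq val_inj).
    by rewrite (negbTE ne_j) mulr0.
  apply: inj; rewrite linear0; apply: val_inj; rewrite /= catalecticantE /= ME.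
  rewrite diffop_sumr big1 // => k _; rewrite (diffop_linform_prod _ D0P) //.
  suff -> : mheval D0 (l k) = 0 by rewrite mulr0 scale0r scaler0.
  move/rowP/(_ k): vA0; rewrite !mxE => <-; rewrite /mheval raddf_sum /=.
  by apply: eq_bigr => j _; rewrite mevalZ !mxE.
have lt_m0 : (index m0 B < size B)%N by rewrite index_mem.
pose j0 := Ordinal lt_m0.
(* [y] combines the evaluations at the [l k] into the functional reading off the coefficient of
   [m0]. *)
have /submxP[y yE] : (delta_mx (0 : 'I_1) j0 <= A)%MS by apply: submx_full.
pose fact := (\prod_k (m0 k)`!)%N.
have yAE j : \sum_k y 0 k * mheval 'X_[mn j] (l k) = (j == j0)%:R.
  move/rowP/(_ j): yE; rewrite !mxE eqxx /= => ->.
  by apply: eq_bigr => k _; rewrite mxE.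
pose cst : K := \prod_i ((b i)`!)%:R.
have cst_neq0 : cst != 0.
  by rewrite prodf_seq_neq0; apply/allP => i _ /=; rewrite natr_neq0 -lt0n fact_gt0.
(* The coefficient of [m] in the power product is the value of ['X_[m]] at [l k] times [cst] over
   the factorials of [m]; the rescaling compensates for this at [m0]. *)
exists (fun k => fact%:R / cst * y 0 k).
apply/eqP; rewrite -subr_eq0; apply/eqP.
apply: (@mhomog_eq0 b) => [|m /mem_mhbasisP m_in].
  apply: rpredB; first by apply: mhomogX => i; apply/mem_mhbasisP: i.
  by apply: rpred_sum => k _; apply: rpredZ; apply: linform_prod_mhomog.
have lt_m : (index m B < size B)%N by rewrite index_mem.
have mE : mn (Ordinal lt_m) = m by rewrite /mn nth_index.
have coefE k : (\prod_i linform (l k i) ^+ b i)@_m *+ (\prod_i (m i)`!) =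
    cst * mheval 'X_[m] (l k).
  have /mem_mhbasisP mb := m_in.
  rewrite -mderivm_mcoeff0 -diffopX (@diffop_linform_prod b b) //; last first.
    exact: mhomogX.
  rewrite mcoeffZ [X in _ * X@_0]big1 ?mcoeff1 ?eqxx ?mulr1 => [|i _].
    by congr (_ * _); apply: eq_bigr => i _; rewrite ffactnn.
  by rewrite subnn.
have mfact_neq0 : (\prod_i (m i)`!)%:R != 0 :> K.
  by rewrite natr_prod prodf_seq_neq0; apply/allP => i _ /=; rewrite natr_neq0 -lt0n fact_gt0.
apply: (mulIf mfact_neq0); rewrite mul0r mcoeffB mcoeffX raddf_sum /=.
rewrite mulrBl; apply/eqP; rewrite subr_eq0 mulr_suml; apply/eqP.
transitivity (fact%:R * \sum_k y 0 k * mheval 'X_[m] (l k)).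
  rewrite -mE yAE mE; have -> : (Ordinal lt_m == j0) = (m0 == m).
    rewrite -val_eqE /= eq_sym; apply/eqP/eqP => [|-> //].
    by move/(congr1 (nth 0%MM B)); rewrite !nth_index.
  by case: eqP => [<-|_]; rewrite ?mul0r ?mulr0 // mul1r mulr1.
rewrite mulr_sumr; apply: eq_bigr => k _.
rewrite mcoeffZ -[RHS]mulrA mulr_natr coefE.
by rewrite -!mulrA; congr (_ * _); rewrite [RHS]mulrCA mulKf.
Qed.

(** Up to nonzero factorials the two catalecticants are transposes of each other. Here it is enough
    that an operator pairing to zero with all of [U] kills [M]: the rank is then at most that of the
    pairing [phi], which takes values in a space of dimension [\dim U]. *)
Lemma dim_catalecticant_le d (M : mhform K n d) a : (forall i, a i <= d i)%N ->
  (\dim (limg (catalecticant M (tupB d a))) <=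
     \dim (limg (catalecticant M a)))%N.
Proof.
move=> le_ad; set U := limg (catalecticant M a).
pose phi_fun (D : mhform K n (tupB d a)) : 'rV[K]_(\dim U) :=
  \row_j (diffop D (vbasis U)`_j : {mpoly K[nvars n]})@_0.
have phi_lin : linear phi_fun.
  by move=> c D1 D2; apply/rowP => j; rewrite !mxE diffop_linearl mcoeffD mcoeffZ.
pose phiL := GRing.isLinear.Build _ _ _ _ _ phi_lin.
pose phi : {linear _ -> _} := HB.pack phi_fun phiL.
have phiE (D : mhform K n (tupB d a)) j :
    linfun phi D 0 j = (diffop D (vbasis U)`_j)@_0.
  by rewrite lfunE /= mxE.
set f := catalecticant _ _.
have sub_ker : (lker (linfun phi) <= lker f)%VS.
  apply/subvP => D; rewrite !memv_ker => /eqP phiD.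
  have annU u : u \in U -> (diffop D u : {mpoly K[nvars n]})@_0 = 0.
    move=> /coord_vbasis ->.
    rewrite mhform_sumE.
    rewrite diffop_sumr raddf_sum big1 //= => j _.
    by rewrite mcoeffZ -phiE phiD mxE mulr0.
  apply/eqP/val_inj; rewrite /= catalecticantE.
  apply: (@mhomog_eq0 a) => [|m hm].
    rewrite (eq_mhomog (d := tupB d (tupB d a))); last first.
      by move=> i; rewrite /tupB subKn.
    by apply: diffop_mhomog; apply: mhform_mhomog.
  have XmP : 'X_[m] \is @mhomog K s n a by apply: mhomogX.
  (* Differential operators commute, so pairing [D] with the image of ['X_[m]] gives the coefficient
     of [m] in [D M], times factorials. *)
  have := annU _ (memv_img (catalecticant M a) (memvf (MHForm XmP))).
  rewrite catalecticantE /= diffopX diffop_mderivm mderivm_mcoeff0 -mulr_natr.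
  move/eqP; rewrite mulf_eq0 natr_prod => /orP[/eqP //|].
  rewrite prodf_seq_eq0 => /hasP[k _]; rewrite natr_neq0.
  by rewrite eqn0Ngt fact_gt0.
have := limg_ker_dim f fullv; have := limg_ker_dim (linfun phi) fullv.
rewrite !capfv => <- /eqP; have := dimvS sub_ker.
set x := \dim _; set y := \dim _.
have := dimvS (subvf (limg (linfun phi))); rewrite dimvf dim_matrix mul1r.
move=> le_w le_xy /eqP E.
by rewrite -(leq_add2l y) E; apply: leq_add.
Qed.

End Apolarity.

(** * Pigeonhole on words, and lists of monomials in given elements *)

Section Words.

Lemma sum_count_mem (T : finType) (w : seq T) : (\sum_k count_mem k w = size w)%N.
Proof.
elim: w => [|x w IHw]; first by rewrite big1.
rewrite /= big_split /= IHw (bigD1 x) //= eqxx big1 ?addn0 // => k.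
by rewrite eq_sym => /negbTE->.
Qed.

Lemma pigeonhole_word r E (w : seq 'I_r) : (r * E < size w)%N ->
  exists k w', (size w' + E = size w)%N /\ perm_eq w (nseq E k ++ w').
Proof.
move=> lt_w; have [k le_E] : exists k, (E <= count_mem k w)%N.
  apply/existsP; apply: contraLR lt_w; rewrite negb_exists -leqNgt => /forallP small.
  rewrite -sum_count_mem -[X in (_ <= X * _)%N]card_ord -sum_nat_const.
  by apply: leq_sum => k _; apply: ltnW; rewrite ltnNge.
exists k, (nseq (count_mem k w - E) k ++ [seq j <- w | j != k]).
rewrite catA -nseqD subnKC //; split.
  rewrite size_cat size_nseq size_filter addnAC subnK //.
  exact: (count_predC (pred1 k)).
have -> : nseq (count_mem k w) k = filter (pred1 k) w.
  by rewrite -size_filter; apply/esym/all_pred1P/filter_all.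
by rewrite perm_sym; apply/permPl/(perm_filterC (pred1 k)).
Qed.

Variable R : comNzRingType.

(** Splitting on whether the first generator still occurs makes the recursion follow Pascal's rule,
    which yields the count directly. *)
Fixpoint monomials_of (gs : seq R) : nat -> seq R :=
  if gs is g :: gs' then
    fix loop k := monomials_of gs' k ++
      (if k is k'.+1 then [seq g * u | u <- loop k'] else [::])
  else fun k => if k is 0 then [:: 1] else [::].

(** For empty [gs] the truncated predecessor gives 1 in degree 0 and 0 in positive degree, as it
    should. *)
Lemma size_monomials_of gs k :
  size (monomials_of gs k) = 'C((k + size gs).-1, k).
Proof.
elim: gs k => [|g gs IHgs] /=; first by case=> // k; rewrite addn0 bin_small.
elim=> [|k IHk]; first by rewrite cats0 IHgs !bin0.
by rewrite size_cat size_map IHk IHgs !addSn !addnS /= binS.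
Qed.

Lemma mem_monomials_of gs k g u :
  g \in gs -> u \in monomials_of gs k -> g * u \in monomials_of gs k.+1.
Proof.
elim: gs k u => // g0 gs IHgs k u; rewrite inE => g_in.
elim: k u => [|k IHk] u; rewrite [u \in _]mem_cat => /orP[u_in|].
- rewrite [_ \in _]mem_cat; case/orP: g_in => [/eqP->|g_in].
    by rewrite map_f ?orbT //= cats0.
  by rewrite IHgs.
- by [].
- rewrite [_ \in _]mem_cat; case/orP: g_in => [/eqP->|g_in].
    by rewrite map_f ?orbT // [_ \in _]mem_cat u_in.
  by rewrite IHgs.
- case/mapP => u' u'_in ->; rewrite [_ \in _]mem_cat mulrCA map_f ?orbT //.
  exact: IHk.
Qed.

End Words.

(** * Linear algebra modulo a subspace of an algebra *)

Section Span.
Variables (K : fieldType) (A : comAlgType K).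
Implicit Types (I J : A -> Prop) (f g : A).

Definition linear_closed I :=
  I 0 /\ forall (c : K) f g, I f -> I g -> I (c *: f + g).

Definition ideal_like I := linear_closed I /\ forall f g, I f -> I (f * g).

Lemma linear_closed_sum I (T : eqType) (r : seq T) (c : T -> K) (F : T -> A) :
  linear_closed I -> {in r, forall k, I (F k)} -> I (\sum_(k <- r) c k *: F k).
Proof.
move=> [I0 ID]; elim: r => [|k r IHr] IF; first by rewrite big_nil.
rewrite big_cons; apply: ID; first by apply: IF; rewrite mem_head.
by apply: IHr => j j_in; apply: IF; rewrite inE j_in orbT.
Qed.

Definition free_mod I h (u : 'I_h -> A) :=
  forall x : 'I_h -> K, I (\sum_i x i *: u i) -> forall i, x i = 0.

(** With more vectors than generators, the coefficient matrix has a nonzero left kernel vector,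
    which is a relation modulo [I]. *)
Lemma free_mod_le_span I h (u : 'I_h -> A) (S : seq A) :
  linear_closed I -> free_mod I u ->
  (forall i, exists c : 'I_(size S) -> K, I (u i - \sum_j c j *: S`_j)) ->
  (h <= size S)%N.
Proof.
move=> Ilin free /fin_all_exists[c Ic]; rewrite leqNgt; apply/negP => lt_h.
pose C := \matrix_(i < h, j < size S) c i j.
have /rowV0Pn[v /sub_kermxP vC0 v_neq0] : kermx C != 0.
  rewrite kermx_eq0 /row_free; apply: contraTN lt_h => /eqP<-.
  by rewrite -leqNgt rank_leq_col.
case/eqP: v_neq0; apply/rowP => i; rewrite mxE; apply: (free (v 0)).
have -> : \sum_i v 0 i *: u i = \sum_i v 0 i *: (u i - \sum_j c i j *: S`_j).
  under [RHS]eq_bigr do rewrite scalerBr scaler_sumr.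
  rewrite sumrB exchange_big /= [X in _ - X]big1 ?subr0 // => j _.
  under eq_bigr do rewrite scalerA.
  have vCE : \sum_i v 0 i * c i j = (v *m C) 0 j.
    by rewrite mxE; apply: eq_bigr => k _; rewrite mxE.
  by rewrite -scaler_suml vCE vC0 mxE scale0r.
by apply: linear_closed_sum => // k _; apply: Ic.
Qed.

Lemma linear_closed_span_mod I (S : seq A) : linear_closed I ->
  linear_closed (fun f => exists c : 'I_(size S) -> K, I (f - \sum_j c j *: S`_j)).
Proof.
move=> [I0 ID]; split.
  by exists (fun=> 0); rewrite big1 ?subr0 // => j _; rewrite scale0r.
move=> a f g [c1 I1] [c2 I2]; exists (fun j => a * c1 j + c2 j).
have -> : a *: f + g - \sum_j (a * c1 j + c2 j) *: S`_j =
    a *: (f - \sum_j c1 j *: S`_j) + (g - \sum_j c2 j *: S`_j).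
  under eq_bigr do rewrite scalerDl -scalerA.
  by rewrite big_split -scaler_sumr /= scalerBr addrACA opprD.
exact: ID.
Qed.

End Span.

(** * Forms of large multidegree lie in the ideal of the [g k] *)

Section Generation.
Variables (K : fieldType) (s : nat) (n : 'I_s -> nat).
Implicit Types (b d : 'I_s -> nat) (p q f : {mpoly K[nvars n]}).
Implicit Types (J : {mpoly K[nvars n]} -> Prop).

Lemma ex_submnm (m : 'X_{1..nvars n}) b : (forall i, b i <= mhdeg i m)%N ->
  exists2 m', (m' <= m)%MM & forall i, mhdeg i m' = b i.
Proof.
elim/mnm_ind: m b => [|m k IHm] b le_b.
  exists 0%MM; first exact: lepm_refl.
  by move=> i; have := le_b i; rewrite mhdeg0 leqn0 => /eqP.
have [le_bm|lt_mb] := leqP (b (var_block k)) (mhdeg (var_block k) m).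
  have [i|m' le_m' m'b] := IHm b; last first.
    by exists m' => //; apply: lepm_trans le_m' (lem_addr _ _).
  have := le_b i; rewrite mhdegD mhdeg1.
  by case: eqP => [<-//|_]; rewrite addn0.
have [i|m' le_m' m'b] := IHm (fun i => b i - (var_block k == i))%N.
  by have := le_b i; rewrite mhdegD mhdeg1 leq_subLR addnC.
exists (m' + U_(k))%MM.
  by apply/mnm_lepP => j; rewrite !mnmDE leq_add2r; apply/mnm_lepP: j.
move=> i; rewrite mhdegD mhdeg1 m'b; case: eqP => [<-|_]; last by rewrite addn0 subn0.
by rewrite subnK //; apply: leq_ltn_trans lt_mb.
Qed.

Variables (r : nat) (eps e : 'I_s -> nat) (h g u : 'I_r -> {mpoly K[nvars n]}).
Hypothesis spanh : forall m : 'X_{1..nvars n}, (forall i, mhdeg i m = eps i) ->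
  exists y : 'I_r -> K, 'X_[m] = \sum_k y k *: h k.

(** Each monomial of [f] has a divisor of multidegree [eps], a combination of the [h k]. Membership
    in the ideal is phrased through an arbitrary linear [J] containing the products, so that it can
    be iterated with [J] changed. *)
Lemma mhomog_in_ideal b f J : linear_closed J -> f \is b.-mhomog ->
  (forall i, eps i <= b i)%N ->
  (forall k q, q \is (fun i => b i - eps i)%N.-mhomog -> J (h k * q)) -> J f.
Proof.
move=> Jlin /mhomogP fb le_b Jh; rewrite [f]mpolyE.
apply: linear_closed_sum => // m /fb mb.
have [i|m' le_m' m'eps] := @ex_submnm m eps; first by rewrite mb.
have [y yE] := spanh m'eps.
rewrite -(submK le_m') mpolyXD mulrC yE mulr_suml.
under eq_bigr do rewrite -scalerAl.
apply: linear_closed_sum => // k _; apply: Jh; apply: mhomogX => i.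
by rewrite -m'eps -mb -{2}(submK le_m') mhdegD addnK.
Qed.

Lemma mhomog_in_word_ideal N b f J : linear_closed J -> f \is b.-mhomog ->
  (forall i, N * eps i <= b i)%N ->
  (forall (w : seq 'I_r) q, size w = N ->
     q \is (fun i => b i - N * eps i)%N.-mhomog -> J (\prod_(k <- w) h k * q)) ->
  J f.
Proof.
move=> Jlin fb; elim: N => [|N IHN] le_b Jw.
  rewrite -[f]mul1r; have := Jw [::] f erefl; rewrite big_nil; apply.
  by rewrite (eq_mhomog (d := b)) // => i; rewrite mul0n subn0.
apply: IHN => [i|w q size_w qP].
  by apply: leq_trans (le_b i); rewrite mulSn leq_addl.
(* The word already extracted is absorbed into the predicate, and one more letter is split off the
   cofactor [q]. *)
apply: (mhomog_in_ideal (J := fun p => J (\prod_(k <- w) h k * p)) _ qP).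
- case: Jlin => J0 JD; split=> [|c p1 p2 J1 J2]; first by rewrite mulr0.
  by rewrite mulrDr -scalerAr; apply: JD.
- by move=> i; have := le_b i; lia.
move=> k q' q'P; have := Jw (k :: w) q'; rewrite big_cons mulrCA mulrA; apply.
  by rewrite /= size_w.
rewrite (eq_mhomog (d := (fun i => b i - N * eps i - eps i)%N)) // => i.
by rewrite mulSn addnC subnDA.
Qed.

Variable E : nat.
Hypothesis h_eps : forall k, h k \is eps.-mhomog.
Hypothesis le_e : forall i, (e i <= E * eps i)%N.
Hypothesis u_homog : forall k, u k \is (fun i => E * eps i - e i)%N.-mhomog.
Hypothesis hE : forall k, h k ^+ E = g k * u k.

(* By the pigeonhole principle, a word of length r * E + 1 in the h k         *)
(* contains some h k at least E times, so is divisible by g k.                *)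
Lemma mhomog_in_power_ideal b f J : linear_closed J -> f \is b.-mhomog ->
  (forall i, (r * E).+1 * eps i <= b i)%N ->
  (forall k q, q \is (fun i => b i - e i)%N.-mhomog -> J (g k * q)) -> J f.
Proof.
move=> Jlin fb le_b Jg; apply: (mhomog_in_word_ideal Jlin fb le_b) => w q sw qP.
have [|k [w' [sw' /(perm_big _)->]]] := @pigeonhole_word r E w; first by rewrite sw.
rewrite big_cat /= big_nseq iter_mulr_1 hE -!mulrA; apply: Jg.
have w'P : \prod_(j <- w') h j \is (fun i => size w' * eps i)%N.-mhomog.
  rewrite (eq_mhomog (d := fun i => \sum_(j <- w') eps i)%N).
    exact: (@mhomog_prod _ _ _ _ _ (fun=> eps)).
  by move=> i; rewrite big_const_seq count_predT iter_addn_0 mulnC.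
have := mhomogM (u_homog k) (mhomogM w'P qP).
rewrite (eq_mhomog (d := (fun i => b i - e i)%N)) // => i.
have := le_e i; have := le_b i; rewrite -sw -sw' mulnDl.
move: (size w' * _)%N (E * _)%N => x y le1 le2.
by lia.
Qed.

End Generation.

(** * Upper bound for the number of forms independent modulo an ideal *)

Section UpperBound.
Variables (K : fieldType) (s : nat) (n : 'I_s -> nat).
Implicit Types (b d : 'I_s -> nat) (p q f : {mpoly K[nvars n]}).
Implicit Types (I J : {mpoly K[nvars n]} -> Prop).

Lemma one_monomials_of (R : comNzRingType) (gs : seq R) : 1 \in monomials_of gs 0.
Proof. by elim: gs => [|g gs IHgs] /=; [exact: mem_head | rewrite cats0]. Qed.

Lemma mem_span_mod (A : comAlgType K) (I : A -> Prop) (S : seq A) x :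
  linear_closed I -> x \in S ->
  exists c : 'I_(size S) -> K, I (x - \sum_j c j *: S`_j).
Proof.
move=> [I0 _] xS; have lt_x : (index x S < size S)%N by rewrite index_mem.
exists (fun j => (j == Ordinal lt_x)%:R); rewrite (bigD1 (Ordinal lt_x)) //= eqxx.
rewrite scale1r nth_index // big1 ?addr0 ?subrr // => j /negbTE->.
by rewrite scale0r.
Qed.

Variables (r : nat) (e : 'I_s -> nat) (g : 'I_r -> {mpoly K[nvars n]}).
Variables (I : {mpoly K[nvars n]} -> Prop) (gs : seq {mpoly K[nvars n]}) (N : nat).
Hypothesis I_ideal : ideal_like I.
Hypothesis g_span : forall k, exists c : 'I_(size gs) -> K,
  I (g k - \sum_j c j *: gs`_j).
Hypothesis g_gen : forall k f J, linear_closed J ->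
  f \is (fun i => (N + k).+1 * e i)%N.-mhomog ->
  (forall j q, q \is (fun i => (N + k) * e i)%N.-mhomog -> J (g j * q)) -> J f.

(** Each unit of [k] splits off one factor [g j], replaced modulo [I] by a combination of [gs].
    After [k] rounds there remain monomials in [gs] of degree [k] times forms of the fixed
    multidegree [N e]. *)
Lemma mhomog_span_mod k J f : linear_closed J -> (forall p, I p -> J p) ->
  (forall u m, u \in monomials_of gs k -> m \in mhbasis n (fun i => N * e i)%N ->
     J (u * 'X_[m])) ->
  f \is (fun i => (N + k) * e i)%N.-mhomog -> J f.
Proof.
elim: k J f => [|k IHk] J f Jlin IJ Jmon fP.
  rewrite [f]mpolyE; apply: linear_closed_sum => // m m_f; rewrite -['X_[m]]mul1r.
  apply: Jmon; first exact: one_monomials_of.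
  by apply/mem_mhbasisP => i; have /mhomogP/(_ m m_f)-> := fP; rewrite addn0.
have [[_ I_D] IM] := I_ideal; have [J0 JD] := Jlin.
rewrite addnS in fP; apply: (g_gen Jlin fP) => j q qP.
have [c Ic] := g_span j.
rewrite -[g j](subrK (\sum_i c i *: gs`_i)) mulrDl mulr_suml.
rewrite -[_ * q]scale1r; apply: (JD); first exact/IJ/IM.
under eq_bigr do rewrite -scalerAl.
apply: linear_closed_sum => // i _.
apply: (IHk (fun p => J (gs`_i * p))) qP.
- split=> [|a p1 p2 J1 J2]; first by rewrite mulr0.
  by rewrite mulrDr -scalerAr; apply: JD.
- by move=> p Ip; apply: IJ; rewrite mulrC; apply: IM.
- by move=> u m u_in m_in; rewrite mulrA; apply/Jmon/m_in/mem_monomials_of/u_in/mem_nth.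
Qed.

Lemma free_mod_card_le k h (u : 'I_h -> {mpoly K[nvars n]}) :
  (forall i, u i \is (fun i => (N + k) * e i)%N.-mhomog) -> free_mod I u ->
  (h <= 'C((k + size gs).-1, k) * size (mhbasis n (fun i => N * e i)%N))%N.
Proof.
move=> uP free; have [Ilin _] := I_ideal.
rewrite -size_monomials_of -(size_allpairs (fun u m => u * 'X_[m])).
set S := [seq _ | u <- _, m <- _].
apply: (free_mod_le_span Ilin free) => i.
pose J p := exists c : 'I_(size S) -> K, I (p - \sum_j c j *: S`_j).
apply: (mhomog_span_mod (J := J) _ _ _ (uP i)).
- exact: linear_closed_span_mod.
- case: Ilin => I0 ID p Ip; exists (fun=> 0).
  by rewrite big1 ?subr0 // => j _; rewrite scale0r.
- by move=> v m v_in m_in; apply: mem_span_mod => //; apply: allpairs_f.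
Qed.

End UpperBound.

(** * Comparison of growth of binomial coefficients *)

Lemma ffact_le_expn m k : (m ^_ k <= m ^ k)%N.
Proof.
elim: k => // k IHk; rewrite ffactnSr expnSr leq_mul ?leq_subr //.
Qed.

Lemma expn_le_ffact q t : (q.+1 ^ t <= (q + t) ^_ t)%N.
Proof.
elim: t => // t IHt; rewrite addnS ffactSS expnS leq_mul //.
by rewrite ltnS leq_addr.
Qed.

(** With [k = q * N - N1], the left side grows in [q] with degree at most [t - 1], the right side
    with degree [t]. *)
Lemma bin_growth t N N1 C : (0 < N)%N ->
  exists q k, (q * N = N1 + k)%N /\ ('C((k + t).-1, k) * C < 'C(q + t, t))%N.
Proof.
move=> N_gt0; pose B := ((N + t) ^ t.-1 * C * t`!)%N.
pose q := (N1 + B).+1; exists q, (q * N - N1)%N.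
have le_q : (N1 < q * N)%N.
  by apply: leq_trans (leq_pmulr _ N_gt0); rewrite ltnS leq_addr.
have k_gt0 : (0 < q * N - N1)%N by rewrite subn_gt0.
have le_k : (q * N - N1 <= q * N)%N by apply: leq_subr.
split; first by rewrite subnKC // ltnW.
move: (q * N - N1)%N k_gt0 le_k => k k_gt0 le_k.
case: t @B @q le_q le_k => [|t] B q le_q le_k.
  by rewrite addn0 bin_small ?mul0n ?bin0 // prednK.
rewrite addnS /= -(ltn_pmul2r (fact_gt0 t.+1)) bin_ffact.
apply: leq_trans (expn_le_ffact q t.+1).
apply: (@leq_ltn_trans ((k + t) ^ t * C * t.+1`!)).
  rewrite leq_mul2r leq_mul2r -[in X in 'C(_, X)](addnK t k) bin_sub ?leq_addl //.
  rewrite (leq_trans _ (ffact_le_expn _ _)) ?orbT // -bin_ffact.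
  by rewrite leq_pmulr // fact_gt0.
apply: (@leq_ltn_trans (((N + t.+1) * q.+1) ^ t * C * t.+1`!)).
  rewrite !leq_mul2r; apply/orP; right; apply/orP; right.
  by case: (posnP t) => [->//|t_gt0]; rewrite leq_exp2r //; nia.
rewrite expnMn expnSr.
have -> : ((N + t.+1) ^ t * q.+1 ^ t * C * t.+1`! = q.+1 ^ t * B)%N.
  by rewrite /B /=; lia.
by rewrite ltn_pmul2l ?expn_gt0 // /q; lia.
Qed.

Section Geometry.
Local Open Scope classical_set_scope.
Variables (K : fieldType) (s : nat) (n e : 'I_s -> nat).
Local Notation eps := (tup_supp e).
Local Notation point := (mpoint K n eps).
Implicit Types (b : 'I_s -> nat) (p q f g : {mpoly K[nvars n]}).
Implicit Types (Z : set point) (L : point).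

Definition point_coords L : forall i, 'rV[K]_(n i) := fun i => vpick (L i).

Lemma dim_point L i : \dim (L i) = eps i.
Proof. by case: L. Qed.

Lemma point_line L i : L i = <[point_coords L i]>%VS.
Proof.
apply/esym/eqP; rewrite eqEdim -memvE memv_pick dim_vline vpick0 -dimv_eq0.
by rewrite dim_point /tup_supp; case: (0 < e i)%N.
Qed.

Lemma point_coords_eq0 L i : (point_coords L i == 0) = (e i == 0%N).
Proof. by rewrite vpick0 -dimv_eq0 dim_point /tup_supp; case: (e i). Qed.

Lemma vanishes_atP b f L : f \is b.-mhomog ->
  vanishes_at f L <-> mheval f (point_coords L) = 0.
Proof.
move=> fb; split=> [|f0 v vL]; first by apply=> i; apply: memv_pick.
have /fin_all_exists[t vE] i : exists c, v i = c *: point_coords L i.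
  by have := vL i; rewrite point_line => /vlineP.
rewrite -[RHS](mulr0 (\prod_i t i ^+ b i)) -f0 -(mheval_scale t _ fb).
by apply: meval_eq => k; rewrite vE.
Qed.

Definition vanishing Z f : Prop :=
  forall L, Z L -> mheval f (point_coords L) = 0.

Lemma vanishing_ideal Z : ideal_like (vanishing Z).
Proof.
split; last by move=> f g fZ L /fZ f0; rewrite /mheval mevalM [_.@[_]]f0 mul0r.
split=> [L _|c f g fZ gZ L ZL]; first exact: meval0.
by rewrite /mheval mevalD mevalZ [f.@[_]](fZ L ZL) [g.@[_]](gZ L ZL) mulr0 addr0.
Qed.

Lemma vanishing_prime Z b b' f g : zariski_irreducible Z ->
  f \is b.-mhomog -> g \is b'.-mhomog -> vanishing Z (f * g) ->
  vanishing Z f \/ vanishing Z g.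
Proof.
move=> [_ irrZ] fb gb fgZ.
have closed1 p c : p \is c.-mhomog -> zariski_closed (zero_locus [set p] : set point).
  by move=> pc; exists [set p]; split=> // _ ->; exists c.
have [L ZL|sub|sub] := irrZ _ _ (closed1 _ _ fb) (closed1 _ _ gb).
- have /eqP := fgZ L ZL; rewrite /mheval mevalM mulf_eq0 => /orP[]/eqP p0.
    by left=> _ ->; apply/(vanishes_atP L fb).
  by right=> _ ->; apply/(vanishes_atP L gb).
- by left=> L /sub/(_ f erefl)/(vanishes_atP L fb).
- by right=> L /sub/(_ g erefl)/(vanishes_atP L gb).
Qed.

Lemma vanishing1 Z : zariski_irreducible Z -> ~ vanishing Z 1.
Proof.
by move=> [[L ZL] _] /(_ L ZL)/eqP; rewrite /mheval meval1 oner_eq0.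
Qed.

Lemma vanishing_exp Z b f k : zariski_irreducible Z -> f \is b.-mhomog ->
  ~ vanishing Z f -> ~ vanishing Z (f ^+ k).
Proof.
move=> irrZ fb fZ; elim: k => [|k IHk]; first exact: vanishing1.
by rewrite exprS => /(vanishing_prime irrZ fb (mhomogXn k fb))[].
Qed.

Lemma vanishing_prod Z (T : Type) (r : seq T) (B : T -> 'I_s -> nat)
    (F : T -> {mpoly K[nvars n]}) : zariski_irreducible Z ->
  (forall j, F j \is (B j).-mhomog) -> (forall j, ~ vanishing Z (F j)) ->
  ~ vanishing Z (\prod_(j <- r) F j).
Proof.
move=> irrZ FB FZ; elim: r => [|j r IHr]; first by rewrite big_nil; apply: vanishing1.
by rewrite big_cons => /(vanishing_prime irrZ (FB j) (mhomog_prod r FB))[/FZ|].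
Qed.

Lemma ex_block_nonvanishing Z i : zariski_irreducible Z ->
  exists x, x \is (fun j => ((j == i) * eps j)%N).-mhomog /\ ~ vanishing Z x.
Proof.
move=> irrZ; have [ei0|ei_gt0] := posnP (e i).
  exists 1; split; last exact: vanishing1.
  rewrite (eq_mhomog (d := fun=> 0%N)) ?mhomog1 // => j.
  by rewrite /tup_supp; case: eqP => // ->; rewrite ei0.
have [[L ZL] _] := irrZ.
have /rV0Pn[j Lj] : point_coords L i != 0 by rewrite point_coords_eq0 -lt0n.
exists (linform (delta_mx 0 j : 'rV_(n i))); split.
  rewrite (eq_mhomog (d := fun k => k == i : nat)) ?linform_mhomog // => k.
  by rewrite /tup_supp; case: eqP => // ->; rewrite ei_gt0.
move=> /(_ L ZL)/eqP; rewrite mheval_linform (bigD1 j) //= mxE !eqxx mul1r.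
rewrite big1 ?addr0 ?(negbTE Lj) // => k ne_k.
by rewrite mxE (negbTE ne_k) andbF mul0r.
Qed.

Lemma mhdeg_inactive Z b f i : f \is b.-mhomog -> ~ vanishing Z f ->
  e i = 0%N -> b i = 0%N.
Proof.
move=> fb fZ ei0; apply/eqP/contraT => bi_neq0; case: fZ => L _.
have := mheval_scale (fun j => (j != i)%:R) (point_coords L) fb.
rewrite (bigD1 i) //= eqxx expr0n (negbTE bi_neq0) !mul0r => <-.
have L0 j : (j != i)%:R *: point_coords L j = point_coords L j.
  have [->|_] := eqVneq j i; last by rewrite scale1r.
  by rewrite scale0r; apply/esym/eqP; rewrite point_coords_eq0 ei0.
by apply: meval_eq => k; rewrite L0.
Qed.

Lemma ex_pad_multidegree Z b f : zariski_irreducible Z -> f \is b.-mhomog ->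
  ~ vanishing Z f -> exists N q, [/\ (0 < N)%N,
    f * q \is (fun i => N * e i)%N.-mhomog & ~ vanishing Z (f * q)].
Proof.
move=> irrZ fb fZ; pose N := (\sum_i b i).+1.
have le_b i : (b i <= N * e i)%N.
  have [ei0|ei_gt0] := posnP (e i); first by rewrite (mhdeg_inactive fb fZ ei0).
  apply: leq_trans (leq_pmulr _ ei_gt0); apply: leqW.
  by rewrite (bigD1 i) //= leq_addr.
have /fin_all_exists[x xP] i := ex_block_nonvanishing i irrZ.
pose a i := (N * e i - b i)%N.
have xaP i := mhomogXn (a i) (xP i).1.
have qP := mhomog_prod (index_enum 'I_s) xaP.
exists N, (\prod_i x i ^+ a i); split=> //.
  have := mhomogM fb qP; rewrite (eq_mhomog (d := fun i => N * e i)%N) // => i /=.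
  rewrite (bigD1 i) //= eqxx mul1n big1 ?addn0 => [|j]; last first.
    by rewrite eq_sym => /negbTE->; rewrite mul0n muln0.
  have [ei0|ei_gt0] := posnP (e i).
    by rewrite (mhdeg_inactive fb fZ ei0) /a /tup_supp ei0 !muln0.
  by rewrite /tup_supp ei_gt0 muln1 /a subnKC.
move=> /(vanishing_prime irrZ fb qP)[/fZ//|].
apply: (vanishing_prod irrZ xaP) => i.
by have [xiP xiZ] := xP i; apply: vanishing_exp irrZ xiP xiZ.
Qed.

Definition has_free_forms Z (D h : nat) : Prop :=
  exists u : 'I_h -> {mpoly K[nvars n]},
    (forall i, u i \is (fun j => D * e j)%N.-mhomog) /\ free_mod (vanishing Z) u.

Lemma has_free_forms_le Z D h h' : (h' <= h)%N ->
  has_free_forms Z D h -> has_free_forms Z D h'.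
Proof.
move=> /subnKC<- [u [uP free]]; exists (fun i => u (lshift _ i)); split=> // x xu i.
pose x' (k : 'I_(h' + (h - h'))) := if split k is inl j then x j else 0.
have := free x'; rewrite big_split_ord /= [X in vanishing _ (_ + X)]big1 => [|j _].
  rewrite addr0 => /(_ _ (lshift _ i)); rewrite {2}/x' (unsplitK (inl i)); apply.
  by under eq_bigr => j _ do rewrite /x' (unsplitK (inl j)).
by rewrite /x' (unsplitK (inr j)) scale0r.
Qed.

Lemma has_free_forms1 Z D f : f \is (fun j => D * e j)%N.-mhomog ->
  ~ vanishing Z f -> has_free_forms Z D 1.
Proof.
move=> fP fZ; exists (fun=> f); split=> // x; rewrite big_ord1 => xf i.
rewrite (ord1 i); apply/eqP/contraT => x_neq0; case: fZ.
have [[I0 ID] _] := vanishing_ideal Z.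
by rewrite -[f](scalerK x_neq0) -[X in vanishing _ X]addr0; apply: ID.
Qed.

(* Restricting a relation mod Z to Z' kills the multiples of y, and dividing  *)
(* by y what remains uses that Z is irreducible.                              *)
Lemma has_free_forms_add Z Z' y N D h h' :
  zariski_irreducible Z -> Z' `<=` Z -> y \is (fun j => N * e j)%N.-mhomog ->
  vanishing Z' y -> ~ vanishing Z y ->
  has_free_forms Z D h -> has_free_forms Z' (N + D) h' ->
  has_free_forms Z (N + D) (h + h').
Proof.
move=> irrZ subZ yP yZ' yZ [u [uP free]] [u' [u'P free']].
pose w k := match split k with inl i => y * u i | inr i => u' i end.
exists w; split=> [k|x xw k].
  rewrite /w; case: split => // i.
  rewrite (eq_mhomog (d := fun j => N * e j + D * e j)%N); first exact: mhomogM.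
  by move=> j; rewrite mulnDl.
move: xw; rewrite big_split_ord /=.
under eq_bigr => i _ do rewrite /w (unsplitK (inl i)) scalerAr.
rewrite -mulr_sumr.
under [X in _ + X]eq_bigr => i _ do rewrite /w (unsplitK (inr i)).
set S := (X in y * X); set S' := (X in _ + X) => xw.
have x'0 i : x (rshift h i) = 0.
  apply: (free' (fun i => x (rshift h i))) i => L Z'L.
  by have := xw L (subZ _ Z'L); rewrite /mheval mevalD mevalM [y.@[_]]yZ' // mul0r add0r.
have S'0 : S' = 0 by rewrite /S' big1 // => i _; rewrite x'0 scale0r.
rewrite S'0 addr0 in xw.
have SP : S \is (fun j => D * e j)%N.-mhomog.
  by apply: rpred_sum => i _; apply: rpredZ.
have [/yZ//|SZ] := vanishing_prime irrZ yP SP xw.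
rewrite -(splitK k); case: (split k) => i /=; last exact: x'0.
exact: (free (fun i => x (lshift h' i))) i.
Qed.

Lemma ex_separating_form Z Z' : zariski_closed Z' -> Z' `<` Z ->
  exists b f, [/\ f \is b.-mhomog, vanishing Z' f & ~ vanishing Z f].
Proof.
move=> [F [Fhom Z'E]] [sub nsub]; apply/not_existsP => none; apply: nsub => L ZL.
rewrite Z'E => f Ff; have [b fb] := Fhom f Ff; apply/(vanishes_atP L fb).
have [fZ|fZ] := pselect (vanishing Z f); first exact: fZ.
case: (none b); exists f; split=> // L'; rewrite Z'E => /(_ f Ff).
by move/(vanishes_atP L' fb).
Qed.

Lemma ex_free_forms_chain m (Z : nat -> set point) :
  (forall k, (k <= m)%N -> zariski_closed (Z k) /\ zariski_irreducible (Z k)) ->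
  (forall k, (k < m)%N -> Z k `<` Z k.+1) ->
  exists2 N, (0 < N)%N & forall k, has_free_forms (Z m) (k * N) 'C(k + m, m).
Proof.
elim: m => [|m IHm] clirr chain.
  have [_ irrZ] := clirr 0%N (leqnn _).
  have [N [q0 [N_gt0]]] := ex_pad_multidegree irrZ (mhomog1 K n) (vanishing1 irrZ).
  rewrite mul1r => q0P q0Z; exists N => // k; rewrite bin0.
  apply: (has_free_forms1 (f := q0 ^+ k)); last exact: vanishing_exp irrZ q0P q0Z.
  rewrite (eq_mhomog (d := fun i => k * (N * e i))%N) ?mhomogXn // => i.
  by rewrite mulnA.
have [k le_k|k lt_k|N' N'_gt0 free'] := IHm.
- by apply: clirr; apply: leqW.
- by apply: chain; apply: leqW.
have [_ irrZ] := clirr m.+1 (leqnn _); have [clZ' irrZ'] := clirr m (leqnSn _).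
have ltZ := chain m (leqnn _); have [subZ _] := ltZ.
have [b [f [fb fZ' fZ]]] := ex_separating_form clZ' ltZ.
have [N [q0 [N_gt0 yP yZ]]] := ex_pad_multidegree irrZ fb fZ.
have [_ IM] := vanishing_ideal (Z m).
pose y := (f * q0) ^+ N'.
have yP' : y \is (fun i => N' * N * e i)%N.-mhomog.
  by rewrite (eq_mhomog (d := fun i => N' * (N * e i))%N) ?mhomogXn // => i; rewrite mulnA.
have yZ' : vanishing (Z m) y.
  by rewrite /y -(prednK N'_gt0) exprS -mulrA; apply: (IM f).
exists (N' * N)%N; first by rewrite muln_gt0 N'_gt0.
elim=> [|k IHk].
  rewrite binn; apply: (has_free_forms1 (f := 1)); last exact: vanishing1.
  by rewrite (eq_mhomog (d := fun=> 0%N)) ?mhomog1.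
rewrite mulSn addSn binS.
apply: (has_free_forms_add irrZ subZ yP' yZ' _ IHk).
  exact: vanishing_exp irrZ yP yZ.
rewrite -mulSn [(N' * N)%N]mulnC mulnA.
apply: has_free_forms_le (free' _); rewrite leq_bin2l //.
by rewrite addnS -addSn leq_add2r leq_pmulr.
Qed.

End Geometry.

Section Dimension.
Local Open Scope classical_set_scope.
Variables (K : fieldType) (s : nat) (n e : 'I_s -> nat).
Local Notation point := (mpoint K n (tup_supp e)).
Implicit Types (X : set point) (L : point).

Lemma eq_point L L' : (forall i, (L' i <= L i)%VS) -> L' = L.
Proof.
move=> sub; have eqL i : L' i = L i.
  by apply/eqP; rewrite eqEdim sub !dim_point leqnn.
case: L L' eqL {sub} => [L dimL] [L' dimL'] /= eqL.
have {eqL}E : L' = L by apply: functional_extensionality_dep.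
by move: dimL'; rewrite E => dimL'; congr MPoint; apply: Prop_irrelevance.
Qed.

Lemma zariski_closed1 L : zariski_closed [set L].
Proof.
pose F := [set f : {mpoly K[nvars n]} |
  exists i (c : 'rV[K]_(n i)), f = linform c /\ vanishes_at f L].
exists F; split=> [_ [i [c [-> _]]]|].
  by exists (fun j => j == i : nat); apply: linform_mhomog.
rewrite eqEsubset; split=> [_ -> _ [i [c [-> //]]]|L' FL'].
apply: eq_point => i; have [ei0|ei_gt0] := posnP (e i).
  suff -> : L' i = 0%VS by apply: sub0v.
  by apply/eqP; rewrite -dimv_eq0 dim_point /tup_supp ei0.
have /rV0Pn[j' wj'] : point_coords L i != 0 by rewrite point_coords_eq0 -lt0n.
set w := point_coords L in wj'; pose w' := point_coords L'.
rewrite point_line -memvE (point_line L) -/w -/w'.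
apply/vlineP; exists (w' i 0 j' / w i 0 j'); apply/rowP => j; rewrite mxE.
pose c : 'rV[K]_(n i) := w i 0 j' *: delta_mx 0 j - w i 0 j *: delta_mx 0 j'.
have cE (v : forall i, 'rV[K]_(n i)) :
    mheval (linform c) v = w i 0 j' * v i 0 j - w i 0 j * v i 0 j'.
  have delta_sum (k : 'I_(n i)) :
      \sum_t (delta_mx 0 k : 'rV[K]_(n i)) 0 t * v i 0 t = v i 0 k.
    rewrite (bigD1 k) //= mxE !eqxx mul1r big1 ?addr0 // => t ne_t.
    by rewrite mxE (negbTE ne_t) andbF mul0r.
  rewrite mheval_linform -!delta_sum !mulr_sumr -sumrB; apply: eq_bigr => t _.
  by rewrite !mxE mulrBl !mulrA.
have /FL'/(vanishes_atP L' (linform_mhomog c)) : F (linform c).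
  exists i, c; split=> //; apply/(vanishes_atP L (linform_mhomog c)).
  by rewrite cE mulrC subrr.
rewrite cE -/w' => /eqP; rewrite subr_eq0 => /eqP E.
by apply: (mulfI wj'); rewrite E mulrA mulrCA mulfV // mulr1 mulrC.
Qed.

Lemma has_irreducible_chain0 X L : X L -> has_irreducible_chain X 0.
Proof.
move=> XL; exists (fun=> [set L]); split=> // k _; split; last by move=> _ ->.
  exact: zariski_closed1.
split; first by exists L.
by move=> Z1 Z2 _ _ /(_ L erefl)[Z1L|Z2L]; [left|right] => _ ->.
Qed.

Lemma ex_max_nat (P : nat -> Prop) B m : P m -> (forall m, P m -> (m <= B)%N) ->
  exists m, P m /\ forall m', P m' -> (m' <= m)%N.
Proof.
move=> Pm leB; pose p k := `[< P k >].
have ex_p : exists k, p k by exists m; apply/asboolP.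
have le_p k : p k -> (k <= B)%N by move/asboolP/leB.
case: (ex_maxnP ex_p le_p) => k /asboolP Pk max_k.
by exists k; split=> // k' Pk'; apply/max_k/asboolP.
Qed.

Lemma ex_is_dim_le X (B : nat) :
  (forall m, has_irreducible_chain X m -> (m < B)%N) ->
  exists2 delta : int, is_dim X delta & delta + 1 <= B%:Z.
Proof.
move=> ltB; have [X0|] := pselect (X = set0).
  by exists (-1); [left | rewrite addNr].
move/eqP/set0P => [L XL].
have [m Pm|m [chain_m max_m]] := ex_max_nat (B := B) (has_irreducible_chain0 XL).
  exact/ltnW/ltB.
exists m%:Z; first by right; exists m.
by rewrite -PoszD lez_nat addn1; apply: ltB.
Qed.

End Dimension.

Section RankBound.
Local Open Scope classical_set_scope.
Variables (K : fieldType) (charK0 : [pchar K] =i pred0).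
Variables (s : nat) (n d : 'I_s -> nat) (M : mhform K n d) (a : 'I_s -> nat).
Hypothesis le_ad : forall i, (a i <= d i)%N.
Local Notation e := (tupB d a).
Hypothesis catM_inj : injective (catalecticant M (tup_supp e)).
Variables (r : nat) (c : 'I_r -> K) (l : 'I_r -> forall i, 'rV[K]_(n i)).
Hypothesis ME : M = \sum_k c k *: \prod_i linform (l k i) ^+ d i
  :> {mpoly K[nvars n]}.

Let power k : mhform K n e := MHForm (linform_prod_mhomog e (l k)).
Let powers : {vspace mhform K n e} := <<[seq power k | k : 'I_r]>>%VS.
Let U := limg (catalecticant M a).

Lemma limg_catalecticant_sub_powers : (U <= powers)%VS.
Proof.
apply/subvP => _ /memv_imgP[D _ ->].
have -> : catalecticant M a D =
    \sum_k (c k * (\prod_i (d i ^_ a i)%:R * mheval D (l k))) *: power k.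
  apply: val_inj; rewrite /= mhform_sumE catalecticantE ME diffop_sumr.
  apply: eq_bigr => k _.
  by rewrite (diffop_linform_prod _ (mhform_mhomog D)) // scalerA.
apply: memv_suml => k _; apply: memvZ; apply: memv_span.
by apply/mapP; exists k; rewrite ?mem_enum.
Qed.

Lemma dim_powers : (\dim powers <= r)%N.
Proof. by apply: leq_trans (dim_span _) _; rewrite size_image card_ord. Qed.

Lemma dim_diff_powers : (\dim (powers :\: U) + \dim U = \dim powers)%N.
Proof.
have := dimv_cap_compl powers U.
by rewrite (capv_idPr limg_catalecticant_sub_powers) addnC.
Qed.

Let gs : seq {mpoly K[nvars n]} := map val (vbasis (powers :\: U)).

Lemma power_span_mod (Z : set (mpoint K n (tup_supp e))) k : Z `<=` Sigma M a ->
  exists x : 'I_(size gs) -> K,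
    vanishing Z ((power k : {mpoly K[nvars n]}) - \sum_j x j *: gs`_j).
Proof.
move=> ZS; have [Ilin _] := vanishing_ideal Z.
have Jlin := linear_closed_span_mod gs Ilin.
have : power k \in (powers :\: U + U)%VS.
  rewrite addv_diff; apply: (subvP (addvSl _ _)); apply: memv_span.
  by apply/mapP; exists k; rewrite ?mem_enum.
case/memv_addP => w w_in [_ /memv_imgP[D _ ->] ->].
rewrite (coord_vbasis w_in) /=.
pose J p := exists x : 'I_(size gs) -> K, vanishing Z (p - \sum_j x j *: gs`_j).
have {}Jlin : linear_closed J := Jlin.
suff : J (1 *: mpoly_of_mhform (\sum_j coord (vbasis (powers :\: U)) j w *:
    (vbasis (powers :\: U))`_j) + mpoly_of_mhform (catalecticant M a D)).
  by rewrite scale1r.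
apply: (proj2 Jlin).
  rewrite mhform_sumE; apply: linear_closed_sum => // j _.
  apply: mem_span_mod => //; apply: (map_f val); apply: mem_nth.
  by rewrite size_tuple.
exists (fun=> 0); rewrite big1 ?subr0 => [L /ZS SL|j _]; last by rewrite scale0r.
have hD := mhform_mhomog (catalecticant M a D).
by apply/(vanishes_atP L hD); apply: SL; exists D.
Qed.

Lemma irreducible_chain_lt m :
  has_irreducible_chain (Sigma M a) m -> (m < \dim (powers :\: U))%N.
Proof.
move=> [Z [Zcl Zchain]]; rewrite ltnNge; apply/negP => le_m.
have size_gs : size gs = \dim (powers :\: U) by rewrite size_map size_tuple.
set t := \dim _ in le_m size_gs.
have [k /leq_trans/(_ le_m)/Zcl[]//|k /leq_trans/(_ le_m)/Zchain//|N N_gt0 free] :=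
  @ex_free_forms_chain K s n e t Z.
pose E := (\sum_i e i)%N; pose N1 := (r * E).+1.
pose eps := tup_supp e.
have le_eps i : (eps i <= e i)%N by rewrite /eps /tup_supp; case: (e i).
have le_E i : (e i <= E * eps i)%N.
  rewrite /eps /tup_supp; case: posnP => [->//|_].
  by rewrite muln1 /E (bigD1 i) //= leq_addr.
have spanh := catalecticant_inj_span charK0 (b := eps)
  (fun i => leq_trans (le_eps i) (leq_subr _ _)) ME catM_inj.
pose h k := \prod_i linform (l k i) ^+ eps i.
pose u k := \prod_i linform (l k i) ^+ (E * eps i - e i).
have hE k : h k ^+ E = mpoly_of_mhform (power k) * u k.
  rewrite /= -big_split -prodrXl; apply: eq_bigr => i _ /=.
  by rewrite -exprM -exprD subnKC // mulnC.

have [q [k [qN]]] := bin_growth t N1 (size (mhbasis n (fun i => N1 * e i)%N)) N_gt0.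
rewrite ltnNge => /negP; apply.
have [v [vP v_free]] := free q.
rewrite qN in vP; rewrite -[in X in (_ <= X)%N]size_gs.
apply: (free_mod_card_le (g := fun k => power k) (vanishing_ideal (Z t)) _ _ vP v_free).
- by move=> j; apply: power_span_mod; have [] := Zcl t le_m.
- move=> k' f J Jlin fP Jg.
  apply: (mhomog_in_power_ideal spanh _ le_E _ hE Jlin fP) => [j|j|i|j p pP].
  + exact: linform_prod_mhomog.
  + exact: (linform_prod_mhomog (fun i => E * eps i - e i)%N).
  + apply: leq_mul => //; apply: leqW; exact: leq_addr.
  + apply: Jg; rewrite (eq_mhomog (d := (fun i => (N1 + k').+1 * e i - e i)%N)) // => i.
    by rewrite mulSn addKn.
Qed.

End RankBound.

Theorem theorem3p20 (K : closedFieldType) (charK0 : [pchar K] =i pred0)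
    (s : nat) (n d : 'I_s -> nat) (M : mhform K n d)
    (a : 'I_s -> nat) (le_ad : forall i, (a i <= d i)%N)
    (catM_inj : injective (catalecticant M (tup_supp (tupB d a))))
    (r : nat) (rank_M : is_mh_rank M r) :
  exists delta : int, is_dim (Sigma M a) delta /\
    (\dim (limg (catalecticant M (tupB d a))))%:Z + delta + 1 <= r%:Z.
Proof.
have [[c [l ME]] _] := rank_M.
have [delta dim_delta le_delta] :=
  ex_is_dim_le (fun m => irreducible_chain_lt charK0 catM_inj ME (m := m)).
exists delta; split=> //.
have le_U := dim_catalecticant_le charK0 M le_ad.
have dimE := dim_diff_powers le_ad ME.
have le_r := dim_powers d a l.
by lia.
Qed.
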